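(* Let $G$ be a finite simple connected graph with at least one edge, and let $k$ be a positive integer. If $W(G)=2k+1$ is odd, then $mad(G)\le \frac{2k(k+1)}{2k+1}$. If $W(G)=2k$ is even, then $mad(G)\le k$. Both equalities can be attained: for every integer $k\ge 1$ there is a graph $G$ with $W(G)=2k+1$ and $mad(G)=\frac{2k(k+1)}{2k+1}$, and there is a graph $G$ with $W(G)=2k$ and $mad(G)=k$.
   Context: All graphs are finite, simple and connected. For a graph $G$, $d(u)$ denotes the degree of the vertex $u$. The maximum edge weight of $G$ (a graph with at least one edge) is $W(G)=\max\{d(u)+d(v):\ uv\in E(G)\}$. The maximum average degree of $G$ is $mad(G)=\max\{\bar d(G'):\ G'\subseteq G\}$, the maximum being over all (nonempty, not necessarily connected) subgraphs $G'$ of $G$, where $\bar d(G')=\frac{2|E(G')|}{|V(G')|}$ is the average degree of $G'$. *)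

(* Defs.v *)
From mathcomp Require Import all_boot all_order all_algebra.

Set Implicit Arguments.
Unset Strict Implicit.
Unset Printing Implicit Defensive.

Import Order.TTheory GRing.Theory Num.Theory.

Record sgraph := SGraph {
  vertex :> finType;
  adj : rel vertex;
  adj_sym : symmetric adj;
  adj_irr : irreflexive adj
}.

Definition connected (G : sgraph) : Prop :=
  0 < #|G| /\ forall u v : G, connect (@adj G) u v.

(* Edges are unordered pairs, represented as two-element sets of vertices. *)
Definition edges (G : sgraph) : {set {set G}} :=
  [set [set uv.1; uv.2] | uv : G * G & adj uv.1 uv.2].

Definition degree (G : sgraph) (u : G) : nat := #|[set v : G | adj u v]|.

Definition max_edge_weight (G : sgraph) : nat :=
  \max_(uv : G * G | adj uv.1 uv.2) (degree uv.1 + degree uv.2).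

(* A pair (V', E') of a vertex set and an edge set is a nonempty subgraph of G
   when E' is a set of edges of G all of whose endpoints lie in V'; it need be
   neither induced nor connected. *)
Definition subgraph (G : sgraph) (H : {set G} * {set {set G}}) : bool :=
  [&& H.1 != set0, H.2 \subset edges G & [forall f in H.2, f \subset H.1]].

Local Open Scope ring_scope.

Definition avg_degree (G : sgraph) (H : {set G} * {set {set G}}) : rat :=
  (2 * #|H.2|)%:R / #|H.1|%:R.

(* Average degrees are nonnegative, so the neutral element 0 of the iterated
   maximum does not affect its value as soon as G has a vertex. *)
Definition mad (G : sgraph) : rat :=
  \big[Num.max/0]_(H : {set G} * {set {set G}} | subgraph H) avg_degree H.

(* Main.v *)
Require Import Defs.
From mathcomp Require Import all_boot all_order all_algebra.
From mathcomp Require Import zify ring lra.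

Set Implicit Arguments.
Unset Strict Implicit.
Unset Printing Implicit Defensive.

Import Order.TTheory GRing.Theory Num.Theory.
Local Open Scope ring_scope.

(** In a subgraph with degrees [d'], each non-isolated vertex [u] receives
    [1/d'(u)] from each of its [d'(u)] edges, so the sum of
    [1/d'(u) + 1/d'(v)] over the edges [uv] is at most the number of vertices.
    Since [d'(u) + d'(v) <= W(G)], each summand is at least [2/k] when
    [W(G) = 2k], and at least [1/k + 1/(k+1)] when [W(G) = 2k+1] because
    degrees are integers. The complete bipartite graphs [K_{k,k}] and
    [K_{k,k+1}] attain the bounds. *)

Lemma set2_eqP (T : finType) (x y u v : T) :
  reflect ((x = u /\ y = v) \/ (x = v /\ y = u)) ([set x; y] == [set u; v]).
Proof.
apply: (iffP eqP) => [E|[[-> ->]|[-> ->]]] //; last by rewrite setUC.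
have hx : x \in [set u; v] by rewrite -E set21.
have hy : y \in [set u; v] by rewrite -E set22.
have hu : u \in [set x; y] by rewrite E set21.
have hv : v \in [set x; y] by rewrite E set22.
move: hx hy hu hv; rewrite !in_set2.
case/orP=> /eqP ->; case/orP=> /eqP ->; rewrite ?eqxx ?orbT ?orbb /=.
- by move=> _ /eqP ->; left.
- by left.
- by right.
- by move=> /eqP -> _; left.
Qed.

Lemma edge_mem (G : sgraph) (u v : G) : ([set u; v] \in edges G) = adj u v.
Proof.
apply/imsetP/idP => [[[x y]]|uv]; last first.
  by exists (u, v); rewrite ?inE.
rewrite inE /= => xy /eqP/set2_eqP[[-> ->]|[-> ->]] //.
by rewrite adj_sym.
Qed.

(** Each edge is the image of exactly two ordered pairs, distinct because there are no loops. Sums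
    over edges can thus be taken over ordered pairs of vertices. *)
Lemma card_edge_darts (G : sgraph) (E : {set {set G}}) : E \subset edges G ->
  #|[set p : G * G | [set p.1; p.2] \in E]| = (2 * #|E|)%N.
Proof.
move=> sEG; rewrite -sum1_card.
rewrite (partition_big (fun p : G * G => [set p.1; p.2]) (mem E)) /=; last first.
  by move=> p; rewrite inE.
rewrite mulnC -sum_nat_const; apply: eq_bigr => e eE.
have /imsetP[[u v]] := subsetP sEG _ eE; rewrite inE /= => uv e_uv.
have neq_uv : u != v by apply: contraTneq uv => ->; rewrite adj_irr.
rewrite sum1_card -(_ : #|[set (u, v); (v, u)]| = 2%N); last first.
  by rewrite cards2 xpair_eqE (negbTE neq_uv).
apply: eq_card => -[x y]; rewrite !inE /= unfold_in /= inE /= !xpair_eqE.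
apply/andP/orP => [[_]|].
  by rewrite e_uv => /set2_eqP[[-> ->]|[-> ->]]; rewrite !eqxx; [left|right].
by case=> /andP[/eqP-> /eqP->]; rewrite 1?[[set v; u]]setUC -e_uv eqxx.
Qed.

Lemma degree_edge_le (G : sgraph) (u v : G) :
  adj u v -> (degree u + degree v <= max_edge_weight G)%N.
Proof.
move=> uv.
exact: (leq_bigmax_cond (F := fun p : G * G => degree p.1 + degree p.2)%N (u, v)).
Qed.

Lemma avg_degree_le (G : sgraph) (H : {set G} * {set {set G}}) (c : rat) :
    0 < c -> subgraph H ->
    (forall a b : nat, (0 < a)%N -> (0 < b)%N ->
       (a + b <= max_edge_weight G)%N -> 2 / c <= a%:R^-1 + b%:R^-1) ->
  avg_degree H <= c.
Proof.
case: H => V E c_gt0 /and3P[/= V0 sEG /forall_inP sEV] Hc; rewrite /avg_degree /=.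
pose P := [set p : G * G | [set p.1; p.2] \in E].
(* [D] is the degree within the subgraph, bounded by the degree in [G]. *)
pose D u := #|[set v : G | [set u; v] \in E]|.
have Dsym u v : [set u; v] \in E -> (0 < D u)%N /\ (0 < D v)%N.
  by move=> uvE; split; apply/card_gt0P; [exists v|exists u]; rewrite inE // setUC.
have D_le u : (D u <= degree u)%N.
  apply/subset_leq_card/subsetP => v; rewrite !inE -edge_mem.
  exact: (subsetP sEG).
(* The [D u] pairs starting at [u] contribute 1 in total if [D u] is positive, which forces [u] into
   [V], and 0 otherwise. *)
have charge : \sum_(p in P) (D p.1)%:R^-1 <= #|V|%:R :> rat.
  rewrite (eq_bigl (fun p : G * G => true && ([set p.1; p.2] \in E))); last first.
    by move=> p; rewrite inE.
  rewrite -(pair_big_dep xpredT (fun u v => [set u; v] \in E)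
              (fun u v => (D u)%:R^-1)) /=.
  rewrite -sum1_card natr_sum [leRHS]big_mkcond /=; apply: ler_sum => u _.
  rewrite sumr_const (_ : #|_| = D u); last by apply: eq_card => v; rewrite !inE.
  have [->|] := posnP (D u); first by rewrite mulr0n; case: ifP.
  move=> Du; have /card_gt0P[v] := Du; rewrite inE => /sEV/subsetP/(_ u).
  rewrite set21 => /(_ isT) ->.
  by rewrite -[_^-1 *+ _]mulr_natr mulVf // pnatr_eq0 -lt0n.
have flip : \sum_(p in P) (D p.2)%:R^-1 = \sum_(p in P) (D p.1)%:R^-1 :> rat.
  rewrite (reindex_inj (can_inj (@swap_pairK G G))) /=.
  by apply: eq_bigl => -[u v]; rewrite !inE /= setUC.
have lower : \sum_(p in P) (2 / c) <= \sum_(p in P) ((D p.1)%:R^-1 + (D p.2)%:R^-1).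
  apply: ler_sum => -[u v]; rewrite inE /= => uvE.
  have [Du Dv] := Dsym _ _ uvE; apply: Hc => //.
  apply: leq_trans (leq_add (D_le u) (D_le v)) _.
  by apply: degree_edge_le; rewrite -edge_mem (subsetP sEG).
(* With [N] the number of ordered pairs, twice the edge count, this says that [N * 2 / c] is at most
   twice the charged sum, hence at most [2 * #|V|]. *)
move: lower; rewrite big_split /= flip sumr_const card_edge_darts // -[_ / c *+ _]mulr_natr.
move: (2 * #|E|)%N => N lower.
have V_gt0 : 0 < #|V|%:R :> rat by rewrite ltr0n card_gt0.
rewrite ler_pdivrMr // -ler_pdivrMl //.
move: lower charge; rewrite -mulrA; lra.
Qed.

Lemma mad_le (G : sgraph) (c : rat) : 0 < c ->
    (forall a b : nat, (0 < a)%N -> (0 < b)%N ->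
       (a + b <= max_edge_weight G)%N -> 2 / c <= a%:R^-1 + b%:R^-1) ->
  mad G <= c.
Proof.
(* The iterated maximum starts at 0, so [c] has to bound 0 as well as each average degree. *)
move=> c_gt0 Hc; apply: (big_ind (fun x => x <= c)) => [|x y xc yc|H sH].
- exact: ltW.
- by rewrite ge_max xc.
- exact: avg_degree_le.
Qed.

(** For [c = p / q], clearing denominators in [2 / c <= 1/a + 1/b = (a + b) / (a * b)] leaves an
    inequality between natural numbers. *)
Lemma mad_le_ratio (G : sgraph) (p q : nat) : (0 < p)%N -> (0 < q)%N ->
    (forall a b : nat, (a + b <= max_edge_weight G)%N ->
       (2 * q * (a * b) <= p * (a + b))%N) ->
  mad G <= p%:R / q%:R.
Proof.
move=> p_gt0 q_gt0 Hpq.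
have p0 : 0 < p%:R :> rat by rewrite ltr0n.
have q0 : 0 < q%:R :> rat by rewrite ltr0n.
apply: mad_le => [|a b a_gt0 b_gt0 /Hpq]; first exact: divr_gt0.
have a0 : 0 < a%:R :> rat by rewrite ltr0n.
have b0 : 0 < b%:R :> rat by rewrite ltr0n.
have -> : a%:R^-1 + b%:R^-1 = (a + b)%:R / (a * b)%:R :> rat.
  by rewrite natrD natrM; field; rewrite !gt_eqF.
rewrite invf_div mulrA ler_pdivlMr ?ltr0n ?muln_gt0 ?a_gt0 //.
rewrite mulrAC ler_pdivrMr // -!natrM ler_nat.
by rewrite [(p * _)%N]mulnC.
Qed.

(** With [p = k] and [q = 1], the claim follows from [4ab <= (a + b)^2 <= 2k(a + b)]. *)
Lemma mad_le_even (G : sgraph) (k : nat) : (0 < k)%N ->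
  max_edge_weight G = (2 * k)%N -> mad G <= k%:R.
Proof.
move=> k_gt0 W; have -> : k%:R = k%:R / 1%:R :> rat by rewrite divr1.
apply: mad_le_ratio => // a b.
rewrite W => ab; have [AGM _] := nat_AGM2 a b.
have := leq_mul (leqnn (a + b)) ab; rewrite expnS expn1 in AGM; lia.
Qed.

Lemma mad_le_odd (G : sgraph) (k : nat) : (0 < k)%N ->
  max_edge_weight G = (2 * k + 1)%N ->
  mad G <= (2 * k * (k + 1))%:R / (2 * k + 1)%:R.
Proof.
move=> k_gt0 W; apply: mad_le_ratio => [||a b]; [nia | lia | rewrite W => ab].
have [s_le|s_gt] := leqP (a + b) (2 * k); last first.
  have {}ab : (a + b = 2 * k + 1)%N by lia.
  (* Integrality enters here: for [b = 2k + 1 - a], the difference [k(k + 1) - ab] equals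
     [(a - k)(a - k - 1)], a product of consecutive integers. *)
  have : (a * b <= k * (k + 1))%N by have [ak|ak] := leqP a k; nia.
  by rewrite ab; nia.
have [AGM _] := nat_AGM2 a b; rewrite expnS expn1 in AGM.
(* For smaller sums the real bound [4ab <= (a + b)^2] suffices, since
   [(2k + 1) * 2k <= 4k(k + 1)]. *)
have : ((2 * k + 1) * (a + b) <= 4 * (k * (k + 1)))%N by nia.
move=> /(leq_mul (leqnn (a + b))); nia.
Qed.

Section CompleteBipartite.
Variables m n : nat.

Definition bip_adj : rel ('I_m + 'I_n)%type := fun x y =>
  match x, y with inl _, inr _ | inr _, inl _ => true | _, _ => false end.

Lemma bip_adj_sym : symmetric bip_adj.
Proof. by case=> x [] y. Qed.

Lemma bip_adj_irr : irreflexive bip_adj.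
Proof. by case. Qed.

Definition complete_bipartite := SGraph bip_adj_sym bip_adj_irr.
Local Notation K := complete_bipartite.

Lemma degree_bip_l (i : 'I_m) : @degree K (inl i) = n.
Proof.
rewrite /degree (_ : [set v | _] = inr @: [set: 'I_n]) ?card_imset ?cardsT ?card_ord //.
  exact: inr_inj.
apply/setP => -[x|x]; rewrite inE /=.
  by apply/esym/negbTE/imsetP => -[].
by rewrite imset_f.
Qed.

Lemma degree_bip_r (j : 'I_n) : @degree K (inr j) = m.
Proof.
rewrite /degree (_ : [set v | _] = inl @: [set: 'I_m]) ?card_imset ?cardsT ?card_ord //.
  exact: inl_inj.
apply/setP => -[x|x]; rewrite inE /=.
  by rewrite imset_f.
by apply/esym/negbTE/imsetP => -[].
Qed.

(** By the handshake count, twice the number of edges is the degree sum [m * n + n * m]. *)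
Lemma card_edges_bip : #|edges K| = (m * n)%N.
Proof.
apply/eqP; rewrite -(eqn_pmul2l (ltn0Sn 1)) -card_edge_darts // -sum1_card.
rewrite (eq_bigl (fun p : K * K => true && bip_adj p.1 p.2)); last first.
  by move=> p; rewrite inE edge_mem.
rewrite -(pair_big_dep xpredT bip_adj (fun _ _ => 1%N)) /=.
rewrite (eq_bigr (@degree K)) => [|x _]; last first.
  by rewrite sum1_card; apply: eq_card => y; rewrite inE.
rewrite big_sumType /= (eq_bigr _ (fun i _ => degree_bip_l i)).
rewrite (eq_bigr _ (fun i _ => degree_bip_r i)) !sum_nat_const !card_ord.
by rewrite [(n * m)%N]mulnC addnn -mul2n.
Qed.

Hypotheses (m_gt0 : (0 < m)%N) (n_gt0 : (0 < n)%N).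
Let i0 := Ordinal m_gt0.
Let j0 := Ordinal n_gt0.

Lemma connected_bip : connected K.
Proof.
split=> [|]; first by apply/card_gt0P; exists (inl i0).
have lr i j : connect (@adj K) (inl i) (inr j) by apply: connect1.
have rl i j : connect (@adj K) (inr j) (inl i) by apply: connect1.
(* Two vertices on the same side are joined through a fixed vertex of the other side. *)
case=> u [] v //.
- exact: connect_trans (lr u j0) (rl v j0).
- exact: connect_trans (rl i0 u) (lr i0 v).
Qed.

Lemma edges_bip_neq0 : edges K != set0.
Proof. by rewrite -card_gt0 card_edges_bip muln_gt0 m_gt0. Qed.

Lemma max_edge_weight_bip : max_edge_weight K = (m + n)%N.
Proof.
apply/eqP; rewrite eqn_leq; apply/andP; split.
  apply/bigmax_leqP => -[[x|x] [y|y]] //= _.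
  - by rewrite degree_bip_l degree_bip_r addnC.
  - by rewrite degree_bip_l degree_bip_r.
have := @degree_edge_le K (inl i0) (inr j0) isT.
by rewrite degree_bip_l degree_bip_r addnC.
Qed.

(** The whole graph is one of the subgraphs over which the maximum is taken. *)
Lemma mad_bip_ge : (2 * (m * n))%:R / (m + n)%:R <= mad K.
Proof.
have -> : (2 * (m * n))%:R / (m + n)%:R = avg_degree ([set: K], edges K).
  by rewrite /avg_degree /= card_edges_bip cardsT card_sum !card_ord.
apply: le_bigmax_cond; rewrite /subgraph /= subxx -card_gt0 cardsT.
case: connected_bip => -> _ /=.
by apply/forall_inP => f _; apply: subsetT.
Qed.

End CompleteBipartite.

Theorem proposition3p1 :
  (forall (G : sgraph) (k : nat),
      connected G -> edges G != set0 -> (0 < k)%N ->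
      (max_edge_weight G = (2 * k + 1)%N ->
         mad G <= (2 * k * (k + 1))%:R / (2 * k + 1)%:R)
      /\ (max_edge_weight G = (2 * k)%N -> mad G <= k%:R))
  /\
  (forall k : nat, (0 < k)%N ->
      (exists G : sgraph,
          [/\ connected G, edges G != set0,
              max_edge_weight G = (2 * k + 1)%N
            & mad G = (2 * k * (k + 1))%:R / (2 * k + 1)%:R])
      /\ (exists G : sgraph,
          [/\ connected G, edges G != set0,
              max_edge_weight G = (2 * k)%N
            & mad G = k%:R])).
Proof.
split=> [G k _ _ k_gt0|k k_gt0].
  by split; [apply: mad_le_odd | apply: mad_le_even].
have k1_gt0 : (0 < k + 1)%N by rewrite addn1.
split.
- have W : max_edge_weight (complete_bipartite k (k + 1)) = (2 * k + 1)%N.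
    by rewrite max_edge_weight_bip //; lia.
  exists (complete_bipartite k (k + 1)); split => //.
  + exact: connected_bip.
  + exact: edges_bip_neq0.
  (* The average degree [2mn / (m + n)] at [m = k], [n = k + 1] is exactly the upper bound. *)
  + apply/le_anti; rewrite mad_le_odd //=.
    by have := mad_bip_ge k_gt0 k1_gt0; rewrite mulnA addnA addnn -mul2n.
- have W : max_edge_weight (complete_bipartite k k) = (2 * k)%N.
    by rewrite max_edge_weight_bip //; lia.
  exists (complete_bipartite k k); split => //.
  + exact: connected_bip.
  + exact: edges_bip_neq0.
  (* At [m = n = k] the average degree [2k * k / (2k)] reduces to [k]. *)
  + apply/le_anti; rewrite mad_le_even //=.
    have := mad_bip_ge k_gt0 k_gt0.
    by rewrite addnn -mul2n mulnA natrM mulrAC divff ?mul1r // pnatr_eq0; lia.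
Qed.
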